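(* Among bounded sublattices of finite products of real chains (with the coordinatewise order), dimension three is the least dimension in which a non-distributive Dedekind–MacNeille completion can occur. That is: (a) if $n\le 2$ and $Y$ is a bounded sublattice of a product of $n$ chains of real numbers, then $\operatorname{DM}(Y)$ is distributive; (b) there is a bounded sublattice $L$ of $\mathbb R^3$ such that $\operatorname{DM}(L)$ is not distributive; moreover $L$ can be chosen to be an infinitely distributive regular sublattice of $\mathbb R^3$.
   Context: The dimension of a finite product of chains is its number of factors. A sublattice is bounded if, as a lattice, it has a least and a greatest element. For a lattice $Y$ and $A\subseteq Y$, $A^+$ and $A^-$ denote the sets of upper and lower bounds of $A$ in $Y$. The Dedekind–MacNeille completion $\operatorname{DM}(Y)$ is the complete lattice of all $C\subseteq Y$ with $C=C^{+-}$, ordered by inclusion. A lattice $L$ is infinitely distributive if whenever $\bigvee A$ exists, $x\wedge\bigvee A=\bigvee_{a\in A}(x\wedge a)$ for every $x\in L$, and whenever $\bigwedge A$ exists, $x\vee\bigwedge A=\bigwedge_{a\in A}(x\vee a)$ for every $x\in L$. A sublattice $Y$ of a lattice $X$ is regular in $X$ if every supremum or infimum of a nonempty subset of $Y$ that exists in $Y$ also exists in $X$, with the same value. *)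

(* Defs.v *)
From HB Require Import structures.
From mathcomp Require Import all_boot all_order all_algebra.
From mathcomp Require Import boolp classical_sets reals.

Set Implicit Arguments.
Unset Strict Implicit.
Unset Printing Implicit Defensive.

Import Order.TTheory.
Local Open Scope classical_set_scope.
Local Open Scope order_scope.

(* A sublattice of X is a [latticeClosed] predicate on X: a subset of X, possibly
   empty, closed under binary meets and joins. [sublattice Y] is such a Y viewed
   as a lattice in its own right. *)
Record sublattice d (X : latticeType d) (Y : latticeClosed X) : Type :=
  MkSublattice {
    sublattice_val :> X;
    _ : sublattice_val \in Y
  }.

HB.instance Definition _ d (X : latticeType d) (Y : latticeClosed X) :=
  [isSub for @sublattice_val d X Y].
HB.instance Definition _ d (X : latticeType d) (Y : latticeClosed X) :=
  [Choice of sublattice Y by <:].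
HB.instance Definition _ d (X : latticeType d) (Y : latticeClosed X) :=
  [SubChoice_isSubLattice of sublattice Y by <: with d].

(* Functions 'I_n -> R carry the pointwise (coordinatewise) order. *)
Definition chain_prod (R : realType) n (C : 'I_n -> {pred R}) :
  {pred 'I_n -> R} := fun x => [forall i, x i \in C i].

Fact chain_prod_meet_closed (R : realType) n (C : 'I_n -> {pred R}) :
  meet_closed (chain_prod C).
Proof.
move=> x y /forallP Cx /forallP Cy; apply/forallP => i.
by rewrite [X in X \in _](_ : _ = x i `&` y i) // meetEtotal minElt; case: ifP.
Qed.

Fact chain_prod_join_closed (R : realType) n (C : 'I_n -> {pred R}) :
  join_closed (chain_prod C).
Proof.
move=> x y /forallP Cx /forallP Cy; apply/forallP => i.
by rewrite [X in X \in _](_ : _ = x i `|` y i) // joinEtotal maxElt; case: ifP.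
Qed.

HB.instance Definition _ (R : realType) n (C : 'I_n -> {pred R}) :=
  Order.isLatticeClosed.Build _ _ (chain_prod C)
    (@chain_prod_meet_closed R n C) (@chain_prod_join_closed R n C).

Definition bounded_lattice d (L : latticeType d) : Prop :=
  exists b t : L, forall x : L, b <= x <= t.

Definition distributive_lattice d (L : latticeType d) : Prop :=
  forall x y z : L, x `&` (y `|` z) = (x `&` y) `|` (x `&` z).

(* [supremums A s] says that the supremum of A exists and equals s; A may be
   empty here. *)
Definition infinitely_distributive d (L : latticeType d) : Prop :=
  (forall (A : set L) (s x : L), supremums A s ->
     supremums [set x `&` a | a in A] (x `&` s)) /\
  (forall (A : set L) (s x : L), infimums A s ->
     infimums [set x `|` a | a in A] (x `|` s)).

Definition regular_sublattice d (X : latticeType d) (Y : latticeClosed X) :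
    Prop :=
  forall (A : set (sublattice Y)) (s : sublattice Y), A !=set0 ->
    (supremums A s -> supremums [set val a | a in A] (val s)) /\
    (infimums A s -> infimums [set val a | a in A] (val s)).

Section DedekindMacNeille.
Variables (d : Order.disp_t) (Y : latticeType d).

Record DM : Type := MkDM {
  dm_set :> set Y;
  _ : lbound (ubound dm_set) == dm_set
}.

HB.instance Definition _ := [isSub for dm_set].
HB.instance Definition _ := [Choice of DM by <:].
(* The order inherited from [set Y] is inclusion, see [subsetEset]. *)
HB.instance Definition _ := [SubChoice_isSubPOrder of DM by <: with d].

Local Open Scope classical_set_scope.
Implicit Types C D E : DM.

Let cl (A : set Y) : set Y := lbound (ubound A).

Let sub_cl A : A `<=` cl A.
Proof. by move=> x Ax y; apply. Qed.

Let cl_mono A B : A `<=` B -> cl A `<=` cl B.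
Proof. by move=> AB x Ax y By; apply: Ax => z /AB; apply: By. Qed.

Let clK A : cl (cl A) = cl A.
Proof.
apply/seteqP; split; last exact: sub_cl.
by move=> x clx y Ay; apply: clx => z; apply.
Qed.

Let clE C : cl C = C. Proof. by apply/eqP; case: C. Qed.

Fact dm_meet_subproof C D : cl (C `&` D) == C `&` D :> set Y.
Proof.
apply/eqP/seteqP; split; last exact: sub_cl.
rewrite subsetI; split; rewrite -[X in _ `<=` X]clE.
  by apply: cl_mono => x [].
by apply: cl_mono => x [].
Qed.

Definition dm_meet C D : DM := MkDM (dm_meet_subproof C D).

Fact dm_join_subproof C D : cl (cl (C `|` D)) == cl (C `|` D).
Proof. by rewrite clK. Qed.

Definition dm_join C D : DM := MkDM (dm_join_subproof C D).

Let leDM C D : (C <= D) = `[< (C : set Y) `<=` D >].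
Proof. by []. Qed.

Fact dm_lexI C D E : (C <= dm_meet D E) = (C <= D) && (C <= E).
Proof.
by rewrite !leDM -asbool_and; apply: asbool_equiv_eq; rewrite /= subsetI.
Qed.

Fact dm_leUx C D E : (dm_join C D <= E) = (C <= E) && (D <= E).
Proof.
rewrite !leDM -asbool_and; apply: asbool_equiv_eq; rewrite -subUset /=.
split => [|CDE]; first exact: subset_trans (@sub_cl _).
by rewrite -(clE E); exact: cl_mono.
Qed.

HB.instance Definition _ :=
  Order.POrder_MeetJoin_isLattice.Build d DM dm_lexI dm_leUx.

End DedekindMacNeille.

(* Main.v *)
Require Import Defs.
From HB Require Import structures.
From mathcomp Require Import all_boot all_order all_algebra.
From mathcomp Require Import boolp classical_sets reals.
From mathcomp Require Import lra.

Set Implicit Arguments.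
Unset Strict Implicit.
Unset Printing Implicit Defensive.

(** Why two chains force distributivity. Suppose an element [e] of
    [E /\ (C \/ D)] in the completion is not below some upper bound [u] of
    [(E /\ C) \/ (E /\ D)]. Normal ideals being downward closed, [e /\ c <= u]
    for every [c] in [C] or [D], so in each coordinate where [u] is smaller than
    [e], all of [C] and [D] stays below [u]. If [u] is smaller than [e] in both
    coordinates, [u] bounds [C] and [D], hence [e <= u]. If it is smaller in one
    coordinate only, [DM_upper_bound_below] gives upper bounds of [C] and of [D]
    that are still smaller than [e] in this coordinate; so is their join, which
    contradicts [e] in [C \/ D]. That lemma is where having only two coordinates
    matters: an element of [C] that is not below [u] exceeds it in the only
    other coordinate, so every upper bound of [C] is there above [e].

    Why three chains do not. The sublattice [gap] of the cube consists of two
    copies of squares from which the axes are removed, put at heights -1 and 1: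
    at height -1 only the part [x < 0] is kept, at height 1 only [0 < y].
    Let [C] be the normal ideal of points of negative [x] and [y], which all lie
    at height -1, let [u = (-1, 1, -1)] and [e = (-1, 1, 1)]. An upper bound of
    [C] has [0 <= x], hence [0 < x] and height 1; an upper bound of [C] and [u]
    is therefore above [e], so [e] lies in [C \/ u]. But everything in [C] below
    [e] is below [u], so [(e /\ C) \/ (e /\ u) = u].

    Removing the axes makes [gap] regular: a point of [gap] can be lowered in
    the [x] or [y] direction by moving inside its sign class, so a supremum in
    [gap] is already the coordinatewise one in these directions; and then a set
    at height -1 whose supremum has height 1 would have a supremum with
    [x <= 0], hence [x < 0], which could be lowered to height -1. Infima follow
    from the anti-automorphism [flip], and infinite distributivity is inherited
    from the power of the chain by regularity. *)

Import Order.TTheory GRing.Theory Num.Theory.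
Local Open Scope classical_set_scope.
Local Open Scope ring_scope.
Local Open Scope order_scope.

(** * Elements and order of the completion *)

Section Completion.
Context d (Y : latticeType d).
Implicit Types (B : set Y) (C D : DM Y).

Lemma DM_closed C : lbound (ubound C) = C :> set Y.
Proof. by apply/eqP; case: C. Qed.

Lemma DM_meetE C D :
  C `&` D = (dm_set C `&` dm_set D)%classic :> set Y.
Proof. by []. Qed.

Lemma DM_joinE C D :
  C `|` D = lbound (ubound (dm_set C `|` dm_set D)) :> set Y.
Proof. by []. Qed.

Lemma DM_leP C D :
  reflect (dm_set C `<=` dm_set D) (C <= D).
Proof. exact: asboolP. Qed.

Lemma DM_downward C (c x : Y) : dm_set C c -> x <= c -> dm_set C x.
Proof.
by rewrite -DM_closed => Cc xc y Cy; apply: le_trans xc (Cc y Cy).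
Qed.

Lemma DM_of_lbound_closed B :
  lbound (ubound (lbound B)) == lbound B.
Proof.
apply/eqP/seteqP; split=> [x xB b Bb|x Bx y yB]; last exact: yB.
by apply: xB => y; apply.
Qed.

Definition DM_of_lbound B : DM Y :=
  MkDM (DM_of_lbound_closed B).

End Completion.

(** * Completions of lattices embedded in two chains *)

Section TwoChains.
Context d d' (Y : latticeType d) (K : orderType d').

Definition two_chain_embedding (p q : Y -> K) : Prop :=
  [/\ {morph p : x y / x `&` y >-> Order.min x y},
      {morph p : x y / x `|` y >-> Order.max x y},
      {morph q : x y / x `&` y >-> Order.min x y},
      {morph q : x y / x `|` y >-> Order.max x y}
    & forall x y, (x <= y) = (p x <= p y) && (q x <= q y)].

Lemma two_chain_embedding_sym (p q : Y -> K) :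
  two_chain_embedding p q -> two_chain_embedding q p.
Proof. by case=> pI pU qI qU pq; split=> // x y; rewrite andbC. Qed.

(** If [u] does not itself bound [C], some [c] in [C] exceeds [u], hence [e], in
    the coordinate [q]; since [e] is not in the normal ideal [C], it is not
    below some upper bound [w] of [C], and [w], being above [c], can only miss
    [e] in the coordinate [p]. *)
Lemma DM_upper_bound_below (p q : Y -> K) (C : DM Y) (u e : Y) :
    two_chain_embedding p q -> (forall c, dm_set C c -> p c <= p u) ->
    p u < p e -> q e <= q u ->
  exists2 w, ubound C w & p w < p e.
Proof.
move=> [_ _ _ _ pq] Cu pue que.
have [uC|/existsNP[c /not_implyP[Cc cu]]] := pselect (ubound C u).
  by exists u.
have quc : q u < q c by move/negP: cu; rewrite pq (Cu _ Cc) -ltNge.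
have : ~ lbound (ubound C) e by rewrite DM_closed => /Cu; rewrite leNgt pue.
move=> /existsNP[w /not_implyP[Cw /negP]].
rewrite pq negb_and -!ltNge => /orP[pwe|qwe]; first by exists w.
have := Cw c Cc; rewrite pq => /andP[_ qcw].
have := lt_trans quc (le_lt_trans qcw (lt_le_trans qwe que)).
by rewrite ltxx.
Qed.

(** The upper bounds [v] of [C] and [w] of [D] can be chosen smaller than [e]
    in the coordinate [p], so [v `|` w] bounds both without being above [e]. *)
Lemma DM_join_not_one_sided (p q : Y -> K) (C D : DM Y) (u e : Y) :
    two_chain_embedding p q -> lbound (ubound (dm_set C `|` dm_set D)) e ->
    (forall c, (dm_set C `|` dm_set D)%classic c -> p c <= p u) ->
    p u < p e -> q e <= q u -> False.
Proof.
move=> pq eCD CDu pue que.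
have [v Cv pve] : exists2 v, ubound C v & p v < p e.
  by apply: DM_upper_bound_below pq _ pue que => c Cc; apply: CDu; left.
have [w Dw pwe] : exists2 w, ubound D w & p w < p e.
  by apply: DM_upper_bound_below pq _ pue que => c Cc; apply: CDu; right.
have : e <= v `|` w.
  by apply: eCD => c [/Cv|/Dw] cle; apply: le_trans cle _; rewrite ?leUl ?leUr.
case: pq => _ pU _ _ ->; rewrite pU.
by rewrite leNgt gt_max pve pwe.
Qed.

Lemma DM_distributive_two_chains (p q : Y -> K) :
  two_chain_embedding p q -> distributive_lattice (DM Y).
Proof.
move=> pq E C D; apply/eqP; rewrite eq_le; apply/andP; split; last first.
  by rewrite leUx !leI2 // (leUl, leUr).
apply/DM_leP => e; rewrite DM_joinE !DM_meetE DM_joinE => -[Ee eCD] u uECD.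
have below c : (dm_set C `|` dm_set D)%classic c -> e `&` c <= u.
  move=> CDc; apply: uECD; case: CDc => [Cc|Dc]; [left|right]; split.
  - exact: DM_downward Ee (leIl _ _).
  - exact: DM_downward Cc (leIr _ _).
  - exact: DM_downward Ee (leIl _ _).
  - exact: DM_downward Dc (leIr _ _).
have coord_le (r s : Y -> K) : two_chain_embedding r s -> r u < r e ->
    forall c, (dm_set C `|` dm_set D)%classic c -> r c <= r u.
  case=> rI _ _ _ rs rue c /below; rewrite rs rI ge_min leNgt rue /=.
  by case/andP.
have qp := two_chain_embedding_sym pq.
have [peu|pue] := leP (p e) (p u); have [qeu|que] := leP (q e) (q u).
- by case: pq => _ _ _ _ ->; rewrite peu qeu.
- by case: (DM_join_not_one_sided qp eCD (coord_le _ _ qp que) que peu).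
- by case: (DM_join_not_one_sided pq eCD (coord_le _ _ pq pue) pue qeu).
apply: eCD => c CDc; case: (pq) => _ _ _ _ ->.
by rewrite (coord_le _ _ pq) ?(coord_le _ _ qp).
Qed.

End TwoChains.

(** * Coordinates on sublattices *)

Lemma le_val_sublattice d (X : latticeType d) (Y : latticeClosed X) :
  {mono (val : sublattice Y -> X) : x y / x <= y}.
Proof. by []. Qed.

Lemma sublattice_valI d (X : latticeType d) (Y : latticeClosed X) :
  {morph (val : sublattice Y -> X) : x y / x `&` y}.
Proof. by []. Qed.

Lemma sublattice_valU d (X : latticeType d) (Y : latticeClosed X) :
  {morph (val : sublattice Y -> X) : x y / x `|` y}.
Proof. by []. Qed.

(** In dimension 0 a constant map and in dimension 1 the unique coordinate, used
    twice, fill the missing places. *)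
Lemma chain_prod_two_chain_embedding (R : realType) n (C : 'I_n -> {pred R})
    (Y : latticeClosed (sublattice (chain_prod C))) : (n <= 2)%N ->
  exists p q : sublattice Y -> R, two_chain_embedding p q.
Proof.
pose coord i (y : sublattice Y) : R := val (val y) i.
have cI i : {morph coord i : x y / x `&` y >-> Order.min x y}.
  by move=> x y; rewrite /coord !sublattice_valI -meetEtotal.
have cU i : {morph coord i : x y / x `|` y >-> Order.max x y}.
  by move=> x y; rewrite /coord !sublattice_valU -joinEtotal.
have cle x y : (x <= y) = [forall i, coord i x <= coord i y].
  by rewrite -!le_val_sublattice; apply/lefP/forallP.
case: n C Y @coord cI cU cle => [|[|[|//]]] C Y coord cI cU cle _.
- exists (fun=> 0), (fun=> 0); split=> [x y|x y|x y|x y|x y];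
    rewrite ?minxx ?maxxx ?lexx //.
  by rewrite cle; apply/forallP => -[].
- exists (coord ord0), (coord ord0); split=> // x y.
  rewrite cle andbb; apply/forallP/idP => [/(_ ord0)//|xy i].
  by rewrite ord1.
- exists (coord ord0), (coord ord_max); split=> // x y.
  rewrite cle; apply/forallP/andP => [xy|[xy0 xy1] i]; first by [].
  have [->|->] // : i = ord0 \/ i = ord_max.
  by case: i => [[|[|//]]] ?; [left|right]; apply: val_inj.
Qed.

(** * Infinite distributivity of powers of a chain and of regular sublattices *)

Lemma fun_meetE (I : Type) d (T : orderType d) (f g : I -> T) i :
  (f `&` g) i = Order.min (f i) (g i).
Proof. by rewrite -meetEtotal. Qed.

Lemma fun_joinE (I : Type) d (T : orderType d) (f g : I -> T) i :
  (f `|` g) i = Order.max (f i) (g i).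
Proof. by rewrite -joinEtotal. Qed.

(** If [w] bounds all [x `&` a] but [w i < x i], then [a i <= w i] for all [a],
    so [s] may be lowered to [w i] at [i] and remains an upper bound. *)
Lemma fun_meet_supremum (I : eqType) d (T : orderType d) (A : set (I -> T))
    (s x : I -> T) :
  supremums A s -> supremums [set x `&` a | a in A] (x `&` s).
Proof.
move=> [As sleast]; split=> [_ [a Aa <-]|w xAw].
  by apply: leI2 => //; apply: As.
apply/lefP => i; rewrite fun_meetE ge_min; have [//|wxi /=] := leP (x i) (w i).
pose t j := if j == i then w i else s j.
suff /sleast/lefP/(_ i) : ubound A t by rewrite /t eqxx.
move=> a Aa; apply/lefP => j; rewrite /t.
case: eqP => [->|_]; last by move/lefP: (As a Aa).
have /lefP/(_ i) : x `&` a <= w by apply: xAw; exists a.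
by rewrite fun_meetE ge_min leNgt wxi.
Qed.

Lemma fun_infinitely_distributive (I : eqType) d (T : orderType d) :
  infinitely_distributive (I -> T).
Proof.
split=> A s x; first exact: fun_meet_supremum.
(* The functions into the dual chain carry, by conversion, the dual order. *)
exact: (@fun_meet_supremum I _ T^d A s x).
Qed.

(** Regularity carries the hypothesis up to [X], where the distributive law is
    known. The empty set escapes regularity, but its supremum (infimum) is the
    least (greatest) element, for which the law is immediate. *)
Lemma regular_infinitely_distributive d (X : latticeType d)
    (Y : latticeClosed X) :
  infinitely_distributive X -> regular_sublattice Y ->
  infinitely_distributive (sublattice Y).
Proof.
move=> [meetX joinX] regY; split=> A s x As.
- split=> [_ [a Aa <-]|w xAw]; first by rewrite leI2 //; apply: (As.1).
  have [A0|/set0P/negP] := pselect (A !=set0); last first.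
    rewrite negbK => /eqP A0; apply: le_trans (leIr _ _) _.
    by apply: As.2; rewrite A0 => y [].
  have [_] := meetX _ _ (val x) ((regY A s A0).1 As).
  rewrite -le_val_sublattice sublattice_valI; apply => _ [_ [a Aa <-] <-].
  by rewrite -sublattice_valI le_val_sublattice; apply: xAw; exists a.
- split=> [_ [a Aa <-]|w xAw]; first by rewrite leU2 //; apply: (As.1).
  have [A0|/set0P/negP] := pselect (A !=set0); last first.
    rewrite negbK => /eqP A0; apply: le_trans (leUr _ _).
    by apply: As.2; rewrite A0 => y [].
  have [_] := joinX _ _ (val x) ((regY A s A0).2 As).
  rewrite -le_val_sublattice sublattice_valU; apply => _ [_ [a Aa <-] <-].
  by rewrite -sublattice_valU le_val_sublattice; apply: xAw; exists a.
Qed.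

(** * A regular sublattice of the cube with non-distributive completion *)

Section Gap.
Variable R : realType.

Definition i0 : 'I_3 := @Ordinal 3 0 isT.
Definition i1 : 'I_3 := @Ordinal 3 1 isT.
Definition i2 : 'I_3 := @Ordinal 3 2 isT.

Definition vec3 (x y z : R) : 'I_3 -> R := fun i => nth z [:: x; y] i.

Lemma vec3E x y z :
  (vec3 x y z i0 = x) * (vec3 x y z i1 = y) * (vec3 x y z i2 = z).
Proof. by []. Qed.

Lemma le3 (v w : 'I_3 -> R) :
  (v <= w) = [&& v i0 <= w i0, v i1 <= w i1 & v i2 <= w i2].
Proof.
apply/lefP/and3P => [vw|[vw0 vw1 vw2] [[|[|[|//]]] lti]]; first by split.
- by rewrite (_ : Ordinal _ = i0) //; apply: val_inj.
- by rewrite (_ : Ordinal _ = i1) //; apply: val_inj.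
- by rewrite (_ : Ordinal _ = i2) //; apply: val_inj.
Qed.

Lemma le3P (v w : 'I_3 -> R) :
  reflect [/\ v i0 <= w i0, v i1 <= w i1 & v i2 <= w i2] (v <= w).
Proof. by rewrite le3; apply: and3P. Qed.

Definition in_gap (x y z : R) : bool :=
  [&& -1 <= x <= 1, -1 <= y <= 1, x != 0, y != 0
    & (z == -1) && (x < 0) || (z == 1) && (0 < y)].

Definition gap : {pred 'I_3 -> R} := fun v => in_gap (v i0) (v i1) (v i2).

Lemma in_gap_opp x y z : in_gap x y z -> in_gap (- y) (- x) (- z).
Proof.
move=> /and5P[xb yb x0 y0 h]; apply/and5P; split; rewrite ?oppr_eq0 //.
- lra.
- lra.
- by rewrite eqr_opp eqr_oppLR oppr_lt0 oppr_gt0 orbC.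
Qed.

(** This is what removing the axes buys: a nonzero real can be lowered towards
    any smaller one without changing its sign or meeting 0. *)
Lemma same_sign_between (w s : R) : s != 0 -> w < s ->
  exists t, [/\ w <= t, t < s, t != 0 & (0 < t) = (0 < s)].
Proof.
move=> s0 ws; have [sp|sn] := ltP 0 s.
  exists (Order.max w (s / 2)).
  have h : 0 < Order.max w (s / 2) by rewrite lt_max; apply/orP; right; lra.
  split=> //; [by rewrite le_max lexx| |by rewrite gt_eqF].
  by rewrite gt_max ws /=; lra.
have {sn}sn : s < 0 by rewrite lt_neqAle s0.
exists ((w + s) / 2); split; [lra|lra|apply/negP => /eqP; lra|].
by apply/negP/negP; rewrite -leNgt; lra.
Qed.

Lemma in_gap_same_sign (x y z x' y' : R) :
    in_gap x y z -> -1 <= x' <= 1 -> -1 <= y' <= 1 ->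
    x' != 0 -> y' != 0 -> (0 < x') = (0 < x) -> (0 < y') = (0 < y) ->
  in_gap x' y' z.
Proof.
move=> /and5P[_ _ x0 y0 h] x'b y'b x'0 y'0 xx' yy'.
have negE (a : R) : a != 0 -> (a < 0) = ~~ (0 < a).
  by move=> a0; rewrite lt_neqAle a0 leNgt.
by apply/and5P; split => //; rewrite yy' negE // xx' -negE.
Qed.

(** A supremum [s] computed inside [gap] is the coordinatewise one. In the first
    two coordinates, otherwise [s] could be lowered within its sign class. In
    the third, failure means that [A] lies at height -1, so [x < 0] on [A], and
    that [s] is at height 1; by the result for the first coordinate [s] also has
    [x < 0], and lowering it to height -1 contradicts leastness. *)
Lemma gap_sup (A : set ('I_3 -> R)) (s w : 'I_3 -> R) :
    A !=set0 -> A `<=` gap -> gap s -> ubound A s ->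
    (forall t, gap t -> ubound A t -> s <= t) ->
  ubound A w -> s <= w.
Proof.
move=> [a0 Aa0] Agap gs As sleast Aw.
have /and5P[a0x a0y _ _ _] := Agap _ Aa0.
have /le3P[sx sy sz] := As _ Aa0.
case/and5P: (gs) => sxb syb sx0 sy0 sgap.
have sxw v : ubound A v -> s i0 <= v i0.
  move=> Av; have /le3P[vx _ _] := Av _ Aa0.
  rewrite leNgt; apply/negP => /(same_sign_between sx0)[t [vt ts t0 tpos]].
  suff : s <= vec3 t (s i1) (s i2) by rewrite le3 !vec3E leNgt ts.
  apply: sleast => [|a Aa].
    by rewrite /gap !vec3E; apply: in_gap_same_sign gs _ _ _ _ _ _ => //; lra.
  have /le3P[ax _ _] := Av _ Aa; have /le3P[_ ay az] := As _ Aa.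
  by apply/le3P; split=> //=; exact: le_trans ax vt.
have syw v : ubound A v -> s i1 <= v i1.
  move=> Av; have /le3P[_ vy _] := Av _ Aa0.
  rewrite leNgt; apply/negP => /(same_sign_between sy0)[t [vt ts t0 tpos]].
  suff : s <= vec3 (s i0) t (s i2).
    by rewrite le3 !vec3E (leNgt (s i1)) ts andbF.
  apply: sleast => [|a Aa].
    by rewrite /gap !vec3E; apply: in_gap_same_sign gs _ _ _ _ _ _ => //; lra.
  have /le3P[_ ay _] := Av _ Aa; have /le3P[ax _ az] := As _ Aa.
  by apply/le3P; split=> //=; exact: le_trans ay vt.
rewrite le3 sxw // syw //=; rewrite leNgt; apply/negP => wsz.
have alow a : A a -> (a i2 == -1) && (a i0 < 0).
  move=> Aa; have /and5P[_ _ _ _] := Agap _ Aa.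
  case/orP => // /andP[/eqP az _]; have /le3P[_ _] := Aw _ Aa.
  rewrite az => aw.
  by case/orP: sgap => /andP[/eqP sz' _]; lra.
have s1 : s i2 = 1.
  case/orP: sgap => /andP[/eqP sz' _] //.
  have /andP[/eqP az _] := alow _ Aa0; have /le3P[_ _ azw] := Aw _ Aa0.
  lra.
have sneg : s i0 < 0.
  rewrite lt_neqAle sx0 (sxw (vec3 0 (s i1) (s i2))) // => a Aa.
  have /le3P[_ ay az] := As _ Aa; have /andP[_ ax] := alow _ Aa.
  by apply/le3P; split=> //=; exact: ltW.
suff : s <= vec3 (s i0) (s i1) (-1) by rewrite le3 !vec3E s1; lra.
apply: sleast => [|a Aa]; last first.
  have /le3P[ax ay _] := As _ Aa; have /andP[/eqP az _] := alow _ Aa.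
  by apply/le3P; split=> //=; rewrite az.
by rewrite /gap !vec3E /in_gap sxb syb sx0 sy0 eqxx sneg.
Qed.

(** The first two coordinates are exchanged because [x < 0] at height -1 has to
    become [0 < y] at height 1. *)
Definition flip (v : 'I_3 -> R) := vec3 (- v i1) (- v i0) (- v i2).

Lemma flip_le v w : (flip v <= flip w) = (w <= v).
Proof. by rewrite !le3 /flip !vec3E !lerN2 andbCA. Qed.

Lemma flipK : involutive flip.
Proof.
by move=> v; apply/eqP; rewrite eq_le !le3 /flip !vec3E !opprK !lexx.
Qed.

Lemma gap_flip v : gap v -> gap (flip v).
Proof. exact: in_gap_opp. Qed.

Lemma gap_inf (A : set ('I_3 -> R)) (s w : 'I_3 -> R) :
    A !=set0 -> A `<=` gap -> gap s -> lbound A s ->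
    (forall t, gap t -> lbound A t -> t <= s) ->
  lbound A w -> w <= s.
Proof.
move=> [a0 Aa0] Agap gs As sgreatest Aw; rewrite -flip_le.
have flipA v : lbound A v -> ubound (flip @` A) (flip v).
  by move=> Av _ [a Aa <-]; rewrite flip_le; apply: Av.
apply: (@gap_sup (flip @` A)); [|
  |exact: gap_flip|exact: flipA| |exact: flipA].
- by exists (flip a0), a0.
- by move=> _ [a Aa <-]; apply: gap_flip; apply: Agap.
- move=> t gt At; rewrite -[t]flipK flip_le; apply: sgreatest.
    exact: gap_flip.
  by move=> a Aa; rewrite -flip_le flipK; apply: At; exists a.
Qed.

(** The lower of two points at different heights brings [x < 0] to the meet,
    which is at its height. *)
Lemma in_gap_min x y z x' y' z' : in_gap x y z -> in_gap x' y' z' ->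
  in_gap (Order.min x x') (Order.min y y') (Order.min z z').
Proof.
move=> /and5P[xb yb x0 y0 h] /and5P[xb' yb' x0' y0' h'].
have minP (P : R -> Prop) a b : P a -> P b -> P (Order.min a b).
  by move=> Pa Pb; case: ltP.
have min_bounded := minP (fun a => -1 <= a <= 1).
have min_nonzero := minP (fun a => a != 0).
apply/and5P; split; [exact: min_bounded|exact: min_bounded
  |exact: min_nonzero|exact: min_nonzero|].
case/orP: h => /andP[/eqP-> xy]; case/orP: h' => /andP[/eqP-> xy'].
- by rewrite minxx eqxx gt_min xy.
- by rewrite min_l ?eqxx ?gt_min ?xy //; lra.
- by rewrite min_r ?eqxx ?gt_min ?xy' ?orbT //; lra.
- by rewrite minxx eqxx lt_min xy xy' orbT.
Qed.

Lemma gap_meet_closed : meet_closed gap.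
Proof.
by move=> v w; rewrite -!topredE /= /gap !fun_meetE; apply: in_gap_min.
Qed.

Lemma gap_join_closed : join_closed gap.
Proof.
move=> v w /in_gap_opp gv /in_gap_opp gw.
have := in_gap_opp (in_gap_min gv gw).
by rewrite !oppr_min !opprK -topredE /= /gap !fun_joinE.
Qed.

HB.instance Definition _ :=
  Order.isLatticeClosed.Build _ _ gap gap_meet_closed gap_join_closed.

Definition gap_lattice : latticeClosed ('I_3 -> R) := gap.

Lemma sublattice_gap (v : sublattice gap_lattice) : gap (val v).
Proof. exact: valP. Qed.

Definition gap_point x y z (g : in_gap x y z) : sublattice gap_lattice :=
  @MkSublattice _ _ gap_lattice (vec3 x y z) g.

Lemma gap_pointE x y z (g : in_gap x y z) (v := val (gap_point g)) :
  (v i0 = x) * (v i1 = y) * (v i2 = z).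
Proof. by []. Qed.

Lemma gap_bounded : bounded_lattice (sublattice gap_lattice).
Proof.
have bot : in_gap (-1) (-1) (-1) by rewrite /in_gap eqxx; lra.
have top : in_gap 1 1 1 by rewrite /in_gap eqxx; lra.
exists (gap_point bot), (gap_point top) => v.
rewrite -!le_val_sublattice !le3 !gap_pointE.
case/and5P: (sublattice_gap v) => /andP[-> ->] /andP[-> ->] _ _ /=.
by case/orP => /andP[/eqP -> _]; lra.
Qed.

Lemma gap_regular : regular_sublattice gap_lattice.
Proof.
move=> A s [a0 Aa0].
have vA0 : [set val a | a in A] !=set0 by exists (val a0), a0.
have vAgap : [set val a | a in A] `<=` gap.
  by move=> _ [a _ <-]; apply: sublattice_gap.
split=> -[As sbest].
- split=> [_ [a Aa <-]|w Aw]; first exact: (As a Aa).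
  apply: (gap_sup vA0 vAgap (sublattice_gap s)) Aw.
    by move=> _ [a Aa <-]; apply: (As a Aa).
  move=> t gt At; apply: (sbest (@MkSublattice _ _ gap_lattice t gt)) => a Aa.
  by apply: At; exists a.
- split=> [_ [a Aa <-]|w Aw]; first exact: (As a Aa).
  apply: (gap_inf vA0 vAgap (sublattice_gap s)) Aw.
    by move=> _ [a Aa <-]; apply: (As a Aa).
  move=> t gt At; apply: (sbest (@MkSublattice _ _ gap_lattice t gt)) => a Aa.
  by apply: At; exists a.
Qed.

Lemma gap_DM_not_distributive :
  ~ distributive_lattice (DM (sublattice gap_lattice)).
Proof.
have gu : in_gap (-1) 1 (-1) by rewrite /in_gap eqxx; lra.
have ge : in_gap (-1) 1 1 by rewrite /in_gap eqxx; lra.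
pose u := gap_point gu; pose e := gap_point ge.
(* The lower bounds of [B] are the points of [gap] with negative [x] and [y]. *)
pose B : set (sublattice gap_lattice) := [set v | 0 < val v i0 /\ 0 < val v i1].
move=> /(_ (DM_of_lbound [set e]) (DM_of_lbound B) (DM_of_lbound [set u])).
move=> /(congr1 (fun C => dm_set C e)).
rewrite DM_joinE !DM_meetE DM_joinE /= => distr.
suff : e <= u by rewrite -le_val_sublattice le3 !gap_pointE; lra.
(* [e] is below every upper bound [t] of [B]'s lower bounds and [u]: if [t] were
   at height -1, its negative first coordinate would be exceeded by that of
   [gap_point gc]. *)
have : lbound [set e] e /\ lbound (ubound (lbound B `|` lbound [set u])) e.
  split=> [_ -> //|t tub].
  have ut : u <= t by apply: tub; right=> _ ->.
  move: ut; rewrite -!le_val_sublattice => /le3P[ut0 ut1 ut2].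
  apply/le3P; split=> //=.
  case/and5P: (sublattice_gap t) => tx _ t0 _.
  case/orP=> [/andP[_ tneg]|/andP[/eqP-> _]//].
  have gc : in_gap (val t i0 / 2) (-1) (-1).
    by rewrite /in_gap eqxx; lra.
  have : gap_point gc <= t.
    apply: tub; left=> b [b0 b1]; rewrite -le_val_sublattice; apply/le3P.
    case/and5P: (sublattice_gap b) => ? ? _ _ bz.
    by rewrite !gap_pointE; split; lra.
  rewrite -le_val_sublattice => /le3P[]; rewrite !gap_pointE => tt _ _.
  suff : 0 <= val t i0 by rewrite leNgt tneg.
  lra.
(* [u] bounds both meets: a lower bound [v] of [B] at height 1 would have a
   positive second coordinate, which half of it undercuts within [B]. *)
rewrite distr; apply=> v [[/(_ e erefl) ve vB]|[_]]; last exact.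
move: ve; rewrite -!le_val_sublattice => /le3P[v0 v1 v2].
apply/le3P; split=> //; rewrite gap_pointE.
case/and5P: (sublattice_gap v) => _ yb _ _.
case/orP=> [/andP[/eqP-> _]//|/andP[_ vpos]].
have gb : in_gap 1 (val v i1 / 2) 1 by rewrite /in_gap eqxx; lra.
have : v <= gap_point gb by apply: vB; split; rewrite gap_pointE; lra.
rewrite -le_val_sublattice => /le3P[]; rewrite !gap_pointE => _ vv _.
suff : val v i1 <= 0 by rewrite leNgt vpos.
lra.
Qed.

End Gap.

Theorem corollary4p5 (R : realType) :
  (forall (n : nat) (C : 'I_n -> {pred R})
          (Y : latticeClosed (sublattice (chain_prod C))),
     (n <= 2)%N -> bounded_lattice (sublattice Y) ->
     distributive_lattice (DM (sublattice Y)))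
  /\
  (exists L : latticeClosed ('I_3 -> R),
     [/\ bounded_lattice (sublattice L),
         ~ distributive_lattice (DM (sublattice L)),
         infinitely_distributive (sublattice L)
       & regular_sublattice L]).
Proof.
split=> [n C Y n2 _|].
  have [p [q pq]] := chain_prod_two_chain_embedding Y n2.
  exact: DM_distributive_two_chains pq.
exists (gap_lattice R); split.
- exact: gap_bounded.
- exact: gap_DM_not_distributive.
- apply: regular_infinitely_distributive (@gap_regular R).
  exact: fun_infinitely_distributive.
- exact: gap_regular.
Qed.
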